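(* Let $\mathfrak{g}$ be a Lie algebra, $(M,\bullet)$ a $\mathfrak{g}$-module and $T: M \to \mathfrak{g}$ an $\mathcal{O}$-operator on $M$ over $\mathfrak{g}$. Let $\mathfrak{h}\subset\mathfrak{g}$ be a Lie subalgebra and $E\subset\mathfrak{g}$ a subspace such that the quotient $\mathfrak{h}/(E\cap\mathfrak{h})$ is a Lie algebra and the projection $\pi:\mathfrak{h}\to\mathfrak{h}/(E\cap\mathfrak{h})$ is a morphism of Lie algebras. Let $N\subset M$ be an $\mathfrak{h}$-submodule. If $T\big((E\cap\mathfrak{h})^0_N\big)\subset\mathfrak{h}$, then the triple $(\mathfrak{h},E,N)$ is reducible, i.e. there is an $\mathcal{O}$-operator $\overline{T} : (E\cap\mathfrak{h})^0_N \to \mathfrak{h}/(E\cap\mathfrak{h})$ on the $\mathfrak{h}/(E\cap\mathfrak{h})$-module $(E\cap\mathfrak{h})^0_N$ over the Lie algebra $\mathfrak{h}/(E\cap\mathfrak{h})$ such that $\overline{T}(m)\bullet n = T(m)\bullet n$ for all $m,n\in(E\cap\mathfrak{h})^0_N$.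
   Context: All vector spaces are over a field of characteristic $0$. An $\mathcal{O}$-operator on a $\mathfrak{g}$-module $(M,\bullet)$ over the Lie algebra $\mathfrak{g}$ is a linear map $T: M\to\mathfrak{g}$ with $[T(m),T(n)] = T(T(m)\bullet n - T(n)\bullet m)$ for all $m,n\in M$. With $\mathfrak{h},E,N$ as in the claim, $(E\cap\mathfrak{h})^0_N := \{n\in N \mid x\bullet n = 0 \ \ \forall x\in E\cap\mathfrak{h}\}\subset N$. It is a module over the Lie algebra $\mathfrak{h}/(E\cap\mathfrak{h})$ with action $|h|\bullet n = h\bullet n$, where $|h|$ is the class of $h\in\mathfrak{h}$. In the equation $\overline{T}(m)\bullet n = T(m)\bullet n$, the left side uses this action and the right side uses the action of $\mathfrak{g}$ on $M$. *)

(* Defs.v *)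
From HB Require Import structures.
From mathcomp Require Import all_boot all_algebra.
From mathcomp Require Import boolp.

Set Implicit Arguments.
Unset Strict Implicit.
Unset Printing Implicit Defensive.

Import GRing.Theory.
Local Open Scope ring_scope.
Local Open Scope quotient_scope.

(* Vector spaces are lmodTypes over a field, of arbitrary dimension; the
   subspaces of V are the bundled predicates of type submodClosed V. *)

Section Structures.
Variables (K : fieldType) (L M : lmodType K).

Record lieBracket := LieBracket {
  lie :> L -> L -> L;
  lie_linearl : forall y, linear (lie^~ y);
  lie_linearr : forall x, linear (lie x);
  lie_alt : forall x, lie x x = 0;
  lie_jacobi : forall x y z,
    lie x (lie y z) + lie y (lie z x) + lie z (lie x y) = 0
}.

Record lieModule (b : lieBracket) := LieModule {
  lact :> L -> M -> M;
  lact_linearl : forall m, linear (lact^~ m);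
  lact_linearr : forall x, linear (lact x);
  lact_lie : forall x y m,
    lact (b x y) m = lact x (lact y m) - lact y (lact x m)
}.

Definition O_operator (b : lieBracket) (act : lieModule b)
    (T : {linear M -> L}) : Prop :=
  forall m n, b (T m) (T n) = T (act (T m) n - act (T n) m).

Definition lie_subalgebra (b : lieBracket) (h : submodClosed L) : Prop :=
  {in h &, forall x y, b x y \in h}.

Definition lie_submodule (b : lieBracket) (act : lieModule b)
    (h : submodClosed L) (N : submodClosed M) : Prop :=
  {in h & N, forall x n, act x n \in N}.

End Structures.

Definition lie_morphism (K : fieldType) (L L' : lmodType K)
    (b : lieBracket L) (b' : lieBracket L') (f : {linear L -> L'}) : Prop :=
  forall x y, f (b x y) = b' (f x) (f y).

Section Subspace.
Variables (K : fieldType) (V : lmodType K) (S : submodClosed V).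

Record subspace := Subspace { subspace_val : V; _ : subspace_val \in S }.

HB.instance Definition _ := [isSub for subspace_val].
HB.instance Definition _ := [Choice of subspace by <:].
HB.instance Definition _ := [SubChoice_isSubLmodule of subspace by <:].

End Subspace.

Section Quotient.
Variables (K : fieldType) (V : lmodType K) (S : submodClosed V).

(* submodClosed does not inherit from zmodClosed, which Quotient.quot needs. *)
Definition zmod_pred : {pred V} := [pred x | x \in S].

HB.instance Definition _ :=
  GRing.isSubmodClosed.Build K V zmod_pred (submodClosedP S).

Definition quotient := Quotient.quot zmod_pred.

HB.instance Definition _ := GRing.Zmodule.on quotient.

Definition proj (x : V) : quotient := \pi_(Quotient.quot zmod_pred) x.

Lemma proj_eq x y : (proj x == proj y) = (x - y \in S).
Proof. by rewrite -Quotient.idealrBE. Qed.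

Lemma proj_repr (q : quotient) : proj (repr (q : Quotient.quot zmod_pred)) = q.
Proof. exact: reprK. Qed.

Lemma projB : zmod_morphism proj.
Proof. exact: (@pi_is_zmod_morphism V _ 0 (Quotient.quot zmod_pred)). Qed.

Definition quotient_scale (a : K) (q : quotient) : quotient :=
  proj (a *: repr (q : Quotient.quot zmod_pred)).

Lemma quotient_scale_proj a x : quotient_scale a (proj x) = proj (a *: x).
Proof.
by apply/eqP; rewrite proj_eq -scalerBr rpredZ // -proj_eq proj_repr.
Qed.

HB.instance Definition _ := GRing.isZmodMorphism.Build V quotient proj projB.

Fact quotient_scalerA a b q :
  quotient_scale a (quotient_scale b q) = quotient_scale (a * b) q.
Proof. by rewrite -(proj_repr q) !quotient_scale_proj scalerA. Qed.

Fact quotient_scale1r : left_id 1 quotient_scale.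
Proof. by move=> q; rewrite -(proj_repr q) quotient_scale_proj scale1r. Qed.

Fact quotient_scalerDr : right_distributive quotient_scale +%R.
Proof.
move=> a p q; rewrite -(proj_repr p) -(proj_repr q) -raddfD.
by rewrite !quotient_scale_proj scalerDr raddfD.
Qed.

Fact quotient_scalerDl q : {morph quotient_scale^~ q : a b / a + b}.
Proof.
by move=> a b; rewrite -(proj_repr q) !quotient_scale_proj scalerDl raddfD.
Qed.

HB.instance Definition _ := GRing.Zmodule_isLmodule.Build K quotient
  quotient_scalerA quotient_scale1r quotient_scalerDr quotient_scalerDl.

Fact proj_scalable : scalable proj.
Proof. by move=> a x; rewrite -quotient_scale_proj. Qed.

HB.instance Definition _ := GRing.isScalable.Build K V quotient *:%R proj
  proj_scalable.

End Quotient.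

Arguments proj {K V} S _.

Section Subalgebra.
Variables (K : fieldType) (L : lmodType K) (b : lieBracket L).
Variables (h : submodClosed L) (hh : lie_subalgebra b h).

Definition sub_lie (x y : subspace h) : subspace h :=
  Sub (b (val x) (val y)) (hh (valP x) (valP y)).

Fact sub_lie_linearl y : linear (sub_lie^~ y).
Proof. by move=> a u v; apply: val_inj; rewrite /= lie_linearl. Qed.

Fact sub_lie_linearr x : linear (sub_lie x).
Proof. by move=> a u v; apply: val_inj; rewrite /= lie_linearr. Qed.

Fact sub_lie_alt x : sub_lie x x = 0.
Proof. by apply: val_inj; rewrite /= lie_alt. Qed.

Fact sub_lie_jacobi x y z :
  sub_lie x (sub_lie y z) + sub_lie y (sub_lie z x) + sub_lie z (sub_lie x y)
  = 0.
Proof. by apply: val_inj; rewrite /= lie_jacobi. Qed.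

Definition subalgebra_bracket : lieBracket (subspace h) :=
  LieBracket sub_lie_linearl sub_lie_linearr sub_lie_alt sub_lie_jacobi.

End Subalgebra.

(* E :&: h, as a subspace of the vector space h. *)
Section Intersection.
Variables (K : fieldType) (V : lmodType K) (h E : submodClosed V).

Definition cap_in : {pred subspace h} := [pred x | val x \in E].

Fact cap_in_submod_closed : submod_closed cap_in.
Proof.
split=> [|a x y xE yE]; rewrite inE /= ?rpred0 //.
by rewrite rpredD ?rpredZ.
Qed.

HB.instance Definition _ :=
  GRing.isSubmodClosed.Build K (subspace h) cap_in cap_in_submod_closed.

End Intersection.

Arguments cap_in {K V} h E _.

(* (E :&: h)^0_N, as a subspace of M. *)
Section Annihilator.
Variables (K : fieldType) (L M : lmodType K) (b : lieBracket L).
Variables (act : lieModule M b) (h E : submodClosed L) (N : submodClosed M).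

Definition annihilator : {pred M} :=
  [pred n | (n \in N) &&
            `[< forall x, x \in E -> x \in h -> act x n = 0 >]].

Lemma annihilatorP n :
  reflect (n \in N /\ forall x, x \in E -> x \in h -> act x n = 0)
          (n \in annihilator).
Proof.
by apply: (iffP andP) => -[nN nE]; split=> //; apply/asboolP.
Qed.

Fact annihilator_submod_closed : submod_closed annihilator.
Proof.
split=> [|a m n /annihilatorP[mN mE] /annihilatorP[nN nE]].
  apply/annihilatorP; split=> [|x _ _]; first exact: rpred0.
  by have := lact_linearr act x (-1) 0 0; rewrite scaler0 addr0 scaleN1r addNr.
apply/annihilatorP; split=> [|x xE xh]; first by rewrite rpredD ?rpredZ.
by rewrite lact_linearr mE // nE // scaler0 addr0.
Qed.

HB.instance Definition _ :=
  GRing.isSubmodClosed.Build K M annihilator annihilator_submod_closed.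

End Annihilator.

(* (E :&: h)^0_N as a module over h / (E :&: h). The action is computed on a
   representative; that pi is a morphism makes E :&: h an ideal of h, whence
   annihilator_stable, and quotient_act_proj is the independence of the
   representative. *)
Section Reduction.
Variables (K : fieldType) (L M : lmodType K) (b : lieBracket L).
Variables (act : lieModule M b) (h E : submodClosed L) (N : submodClosed M).
Hypothesis hh : lie_subalgebra b h.
Variable bQ : lieBracket (quotient (cap_in h E)).
Hypothesis hpi :
  lie_morphism (subalgebra_bracket hh) bQ (proj (cap_in h E)).
Hypothesis hN : lie_submodule act h N.

Local Notation A := (annihilator act h E N).
Local Notation Q := (quotient (cap_in h E)).
Local Notation pi := (proj (cap_in h E)).

Fact annihilator_stable (x : subspace h) (n : subspace A) :
  act (val x) (val n) \in A.
Proof.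
have /annihilatorP[nN nE] := valP n.
apply/annihilatorP; split=> [|y yE yh]; first exact: hN (valP x) nN.
pose y' : subspace h := Sub y yh.
have bQ0 q : bQ 0 q = 0.
  by have := lie_linearl bQ q (-1) 0 0; rewrite scaler0 addr0 scaleN1r addNr.
have piy : pi y' = 0.
  by apply/eqP; rewrite -(raddf0 pi) proj_eq subr0.
have yxE : b y (val x) \in E.
  have /eqP : pi (subalgebra_bracket hh y' x) = 0.
    by rewrite [LHS]hpi [X in bQ X _]piy bQ0.
  by rewrite -(raddf0 pi) proj_eq subr0.
have act0 : act (val x) 0 = 0.
  by have := lact_linearr act (val x) (-1) 0 0;
     rewrite scaler0 addr0 scaleN1r addNr.
have := lact_lie act y (val x) (val n).
rewrite (nE y) // act0 subr0 => <-.
by apply: nE => //; apply: hh => //; exact: valP.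
Qed.

Definition quotient_act (q : Q) (n : subspace A) : subspace A :=
  Sub (act (val (repr (q : Quotient.quot (zmod_pred (cap_in h E))))) (val n))
      (annihilator_stable _ n).

Lemma quotient_act_proj (x : subspace h) (n : subspace A) :
  val (quotient_act (pi x) n) = act (val x) (val n).
Proof.
have /annihilatorP[_ nE] := valP n.
rewrite /=; set y := repr _; apply/eqP; rewrite -subr_eq0.
have <- : act (val y - val x) (val n)
        = act (val y) (val n) - act (val x) (val n).
  by rewrite addrC -scaleN1r lact_linearl scaleN1r addrC.
apply/eqP/nE; last exact: (valP (y - x)).
suff: y - x \in cap_in h E by [].
by rewrite -proj_eq; apply/eqP; exact: proj_repr.
Qed.

Fact quotient_act_linearl n : linear (quotient_act^~ n).
Proof.
move=> a p q; apply: val_inj; rewrite -(proj_repr p) -(proj_repr q) -linearP.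
by rewrite quotient_act_proj [LHS]lact_linearl -!quotient_act_proj.
Qed.

Fact quotient_act_linearr q : linear (quotient_act q).
Proof. by move=> a m n; apply: val_inj; rewrite /= lact_linearr. Qed.

Fact quotient_act_lie p q n :
  quotient_act (bQ p q) n
  = quotient_act p (quotient_act q n) - quotient_act q (quotient_act p n).
Proof.
apply: val_inj; rewrite -(proj_repr p) -(proj_repr q) -hpi.
by rewrite quotient_act_proj [LHS]lact_lie -!quotient_act_proj.
Qed.

Definition quotient_module : lieModule (subspace A) bQ :=
  LieModule quotient_act_linearl quotient_act_linearr quotient_act_lie.

(* Reducibility of the triple (h, E, N). *)
Definition reducible (T : {linear M -> L}) : Prop :=
  exists Tbar : {linear subspace A -> Q},
    O_operator quotient_module Tbar /\
    forall m n : subspace A,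
      val (quotient_module (Tbar m) n) = act (T (val m)) (val n).

End Reduction.

(* Main.v *)
From HB Require Import structures.
Require Import Defs.
From mathcomp Require Import all_boot all_algebra.

Import GRing.Theory.
Local Open Scope ring_scope.

(* The reduced operator is the composite of [pi] with the restriction of [T] to
   the annihilator. Since [E :&: h] acts by zero on the annihilator, [pi (T m)]
   acts there as [T m] does, and the morphism [pi] carries over the O-operator
   identity of [T]. *)

Section Restriction.
Variables (K : fieldType) (U V : lmodType K) (f : {linear U -> V}).
Variables (A : submodClosed U) (B : submodClosed V).
Hypothesis fAB : {in A, forall u, f u \in B}.

(** The codomain is cut down too: [proj (cap_in h E)] accepts only elements of [subspace h]. *)
Definition restrict (u : subspace A) : subspace B :=
  Sub (f (val u)) (fAB _ (valP u)).

Fact restrict_linear : linear restrict.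
Proof. by move=> a u v; apply: val_inj; rewrite /= linearP. Qed.

HB.instance Definition _ :=
  GRing.isLinear.Build K (subspace A) (subspace B) *:%R restrict
    restrict_linear.

End Restriction.

Arguments restrict {K U V f A B}.

Theorem theorem3p10 (K : fieldType) (charK : [pchar K] =i pred0)
  (g : lmodType K) (b : lieBracket g)
  (M : lmodType K) (act : lieModule M b)
  (T : {linear M -> g}) (hT : O_operator act T)
  (h E : submodClosed g) (hh : lie_subalgebra b h)
  (bQ : lieBracket (quotient (cap_in h E)))
  (hpi : lie_morphism (subalgebra_bracket hh) bQ (proj (cap_in h E)))
  (N : submodClosed M) (hN : lie_submodule act h N)
  (hTN : {in annihilator act h E N, forall n, T n \in h}) :
  reducible hpi hN T.
Proof.
pose t : {linear _ -> subspace h} := restrict hTN.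
pose Tbar : {linear _ -> _} := proj (cap_in h E) \o t.
have actTbar m n :
  val (quotient_module hpi hN (Tbar m) n) = act (T (val m)) (val n).
  exact: quotient_act_proj.
exists Tbar; split=> // m n.
(* Both sides are now classes of elements of [h]; it suffices that these agree as vectors of [g]. *)
rewrite -[LHS]hpi; congr (proj _ _); apply: val_inj.
(* [actTbar], read backwards, turns the two terms under [T] into vectors underlying elements of the
   annihilator, where the identity for [Tbar] takes their difference. *)
by rewrite /= hT linearB -!actTbar -linearB.
Qed.
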